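(* Let $L=\mathfrak{sl}_2(\mathbb{F}_q)$ with $q$ odd, and let $\Gamma(L)$ be its comaximal graph. Then $\chi(\Gamma(L))=\omega(\Gamma(L))=\frac{q^2+q+2}{2}$, where $\chi$ denotes the chromatic number and $\omega$ the clique number.
   Context: The comaximal graph $\Gamma(L)$ of a finite-dimensional Lie algebra $L$ is the simple undirected graph whose vertices are the nonzero proper Lie subalgebras of $L$, two distinct vertices $A,B$ being adjacent if and only if $\langle A,B\rangle=L$, where $\langle A,B\rangle$ denotes the Lie subalgebra generated by $A\cup B$. *)

(* Defs.v *)
From HB Require Import structures.
From mathcomp Require Import all_boot all_order all_algebra.
From mathcomp Require Import ring.

Set Implicit Arguments.
Unset Strict Implicit.
Unset Printing Implicit Defensive.

Import GRing.Theory.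
Local Open Scope ring_scope.

HB.mixin Record Vector_isLie (F : fieldType) V of Vector F V := {
  lie : V -> V -> V;
  lie_linearl : forall y, linear (fun x => lie x y);
  lie_linearr : forall x, linear (lie x);
  liexx : forall x, lie x x = 0;
  lie_jacobi : forall x y z,
    lie x (lie y z) + lie y (lie z x) + lie z (lie x y) = 0
}.

#[short(type="lieType")]
HB.structure Definition Lie (F : fieldType) := {V of Vector_isLie F V & Vector F V}.

(* It suffices to test closure on a basis of [U]: see [lie_closedP]. *)
Definition lie_closed (F : fieldType) (L : lieType F) (U : {vspace L}) : bool :=
  all2rel (fun x y => lie x y \in U) (vbasis U).

Lemma lie_closedP (F : fieldType) (L : lieType F) (U : {vspace L}) :
  reflect {in U &, forall x y, lie x y \in U} (lie_closed U).
Proof.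
apply: (iffP allrelP) => [clU x y Ux Uy | clU x y /vbasis_mem Ux /vbasis_mem Uy];
  last exact: clU.
pose l z := HB.pack_for {linear L -> L} (fun x => lie x z)
  (GRing.isLinear.Build F L L *:%R _ (lie_linearl z)).
pose r z := HB.pack_for {linear L -> L} (lie z)
  (GRing.isLinear.Build F L L *:%R _ (lie_linearr z)).
have bU i : (vbasis U)`_i \in vbasis U \/ (vbasis U)`_i = 0.
  have [lt_i | ge_i] := ltnP i (size (vbasis U)).
    by left; apply: mem_nth.
  by right; rewrite nth_default.
rewrite (coord_vbasis Ux) -[lie _ _]/(l y _) linear_sum.
apply: rpred_sum => i _; rewrite linearZ; apply: rpredZ => /=.
rewrite (coord_vbasis Uy) -[lie _ _]/(r _ _) linear_sum.
apply: rpred_sum => j _; rewrite linearZ; apply: rpredZ => /=.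
by apply: clU; apply: mem_nth; rewrite size_tuple.
Qed.

Section FiniteSubspaces.
Import VectorInternalTheory.
HB.instance Definition _ (F : finFieldType) (V : vectType F) :=
  [Countable of {vspace V} by <:].
HB.instance Definition _ (F : finFieldType) (V : vectType F) :=
  [Finite of {vspace V} by <:].
End FiniteSubspaces.

(* The Lie subalgebra generated by [A] and [B]: the intersection of all Lie
   subalgebras containing both. Over a finite field [L] has finitely many
   subspaces, so this is a finite intersection and the comaximal graph below is
   a finite graph. *)
Definition lie_gen (F : finFieldType) (L : lieType F) (A B : {vspace L}) :
    {vspace L} :=
  (\bigcap_(M : {vspace L} | [&& lie_closed M, A <= M & B <= M]) M)%VS.

Record sgraph := SGraph {
  vertex :> finType;
  edge : rel vertex;
  edge_sym : symmetric edge;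
  edge_irr : irreflexive edge
}.

Definition proper_coloring (G : sgraph) k (c : {ffun G -> 'I_k}) : bool :=
  [forall x, forall y, edge x y ==> (c x != c y)].

Definition colorable (G : sgraph) k : bool :=
  [exists c : {ffun G -> 'I_k}, proper_coloring c].

Lemma colorable_card (G : sgraph) : exists k, colorable G k.
Proof.
exists #|G|; apply/existsP; exists [ffun x => enum_rank x].
apply/forallP=> x; apply/forallP=> y; apply/implyP=> xy; rewrite !ffunE.
by apply: contraTneq xy => /enum_rank_inj ->; rewrite edge_irr.
Qed.

Definition chromatic_number (G : sgraph) : nat := ex_minn (colorable_card G).

Definition clique (G : sgraph) (S : {set G}) : bool :=
  [forall x in S, forall y in S, (x != y) ==> edge x y].

Definition clique_number (G : sgraph) : nat :=
  (\max_(S : {set G} | clique S) #|S|)%N.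

Section Comaximal.
Variables (F : finFieldType) (L : lieType F).

Definition proper_subalgebra : Type :=
  {U : {vspace L} | [&& lie_closed U, U != 0%VS & U != fullv]}.
HB.instance Definition _ := Finite.on proper_subalgebra.

Definition comaximal (A B : proper_subalgebra) : bool :=
  (A != B) && (lie_gen (val A) (val B) == fullv).

Lemma comaximal_sym : symmetric comaximal.
Proof.
move=> A B; rewrite /comaximal eq_sym /lie_gen; congr (_ && (_ == _)).
by apply: eq_bigl => M; rewrite [(_ <= M)%VS && _]andbC.
Qed.

Lemma comaximal_irr : irreflexive comaximal.
Proof. by move=> A; rewrite /comaximal eqxx. Qed.

Definition comaximal_graph : sgraph := SGraph comaximal_sym comaximal_irr.

End Comaximal.

Arguments comaximal_graph {F} L.

Section SpecialLinear.
Variables (F : fieldType) (n : nat).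

Definition sl_space : {vspace 'M[F]_n} :=
  lker (linfun (mxtrace : 'M[F]_n -> F^o)).

Lemma sl_spaceE (A : 'M[F]_n) : (A \in sl_space) = (\tr A == 0).
Proof. by rewrite memv_ker lfunE. Qed.

Definition sl : Type := subvs_of sl_space.
HB.instance Definition _ := Vector.on sl.

Lemma commutator_sl (A B : 'M[F]_n) : A *m B - B *m A \in sl_space.
Proof. by rewrite sl_spaceE linearB /= mxtrace_mulC subrr. Qed.

Definition sl_lie (A B : sl) : sl :=
  Subvs (commutator_sl (vsval A) (vsval B)).

Fact sl_lie_linearl B : linear (fun A => sl_lie A B).
Proof.
move=> a A C; apply: val_inj => /=.
by rewrite mulmxDl mulmxDr -scalemxAl -scalemxAr opprD addrACA scalerBr.
Qed.

Fact sl_lie_linearr A : linear (sl_lie A).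
Proof.
move=> a B C; apply: val_inj => /=.
by rewrite mulmxDl mulmxDr -scalemxAl -scalemxAr opprD addrACA scalerBr.
Qed.

Fact sl_liexx A : sl_lie A A = 0.
Proof. by apply: val_inj; rewrite /= subrr. Qed.

Fact sl_lie_jacobi A B C :
  sl_lie A (sl_lie B C) + sl_lie B (sl_lie C A) + sl_lie C (sl_lie A B) = 0.
Proof.
apply: val_inj => /=; rewrite !mulmxBl !mulmxBr !mulmxA.
move: (vsval A) (vsval B) (vsval C) => a b c.
apply/matrixP=> i j; rewrite !mxE.
move: ((a *m b *m c) i j) ((b *m c *m a) i j) ((c *m a *m b) i j)
  ((a *m c *m b) i j) ((b *m a *m c) i j) ((c *m b *m a) i j).
by move=> *; ring.
Qed.

HB.instance Definition _ := Vector_isLie.Build F sl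
  sl_lie_linearl sl_lie_linearr sl_liexx sl_lie_jacobi.

End SpecialLinear.

(* Main.v *)
(* Over a finite field, the maximal subalgebras of a Lie algebra of dimension at
   least 2 form a clique of its comaximal graph, and sending each vertex to a maximal subalgebra
   containing it is a proper coloring; so both the clique number and the
   chromatic number count the maximal subalgebras.

   In sl_2, a 2-dimensional subalgebra <x, y> contains w = [x, y], and
   invariance of the trace form kappa gives kappa(w, x) = kappa(w, y) = 0, hence
   kappa(w, w) = 0: w is nilpotent and <x, y> is the Borel subalgebra
   orthogonal to w. Hence the maximal subalgebras are the q + 1 Borel
   subalgebras, which are the stabilisers of the points of the projective line,
   and the lines fixing no such point. The latter are spanned by matrices
   [[a, b], [c, -a]] with a^2 + bc not a square, thus b != 0; scaling to b = 1
   makes them correspond to pairs (a, d), d = a^2 + c a nonsquare, and there are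
   q (q - 1) / 2 of these. *)

From HB Require Import structures.
Require Import Defs.
From mathcomp Require Import all_boot all_order all_algebra.
From mathcomp Require Import all_fingroup cyclic ring.

Set Implicit Arguments.
Unset Strict Implicit.
Unset Printing Implicit Defensive.

Import GRing.Theory.
Local Open Scope ring_scope.

(** * Colourings and cliques of comaximal graphs *)

(** [f] embeds the complete graph on [T] and [c] colours [G] with [#|T|] colours. A proper colouring
    is injective on a clique, so [#|T|] is squeezed between the clique number and the chromatic
    number. *)
Lemma chromatic_clique_card (G : sgraph) (T : finType) (c : G -> T) (f : T -> G) :
    (forall x y, edge x y -> c x != c y) ->
    (forall s t, s != t -> edge (f s) (f t)) ->
  chromatic_number G = #|T| /\ clique_number G = #|T|.
Proof.
move=> cP fP.
have f_inj : injective f.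
  move=> s t est; apply/eqP; apply: contraTT isT => /fP.
  by rewrite est edge_irr.
have col : colorable G #|T|.
  apply/existsP; exists [ffun x => enum_rank (c x)].
  apply/forallP=> x; apply/forallP=> y; apply/implyP=> /cP.
  by rewrite !ffunE; apply: contra => /eqP/enum_rank_inj ->.
have clq : clique [set f t | t in T].
  apply/forall_inP=> _ /imsetP[s _ ->]; apply/forall_inP=> _ /imsetP[t _ ->].
  by apply/implyP=> st; apply: fP; apply: contra st => /eqP ->.
have clique_le k (S : {set G}) : colorable G k -> clique S -> (#|S| <= k)%N.
  case/existsP=> d /forallP dP /forall_inP SP; rewrite -[k]card_ord.
  rewrite -(@card_in_imset _ _ d); first exact: max_card.
  move=> x y Sx Sy dxy; apply/eqP; apply: contraTT isT => xy.
  have /forall_inP/(_ y Sy)/implyP/(_ xy) exy := SP x Sx.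
  by have /forallP/(_ y) := dP x; rewrite exy dxy eqxx.
rewrite -[#|T|](card_imset _ f_inj); split.
  rewrite /chromatic_number; case: ex_minnP => k /clique_le/(_ clq) ge_k min_k.
  by apply/eqP; rewrite eqn_leq ge_k min_k // card_imset.
apply/eqP; rewrite eqn_leq; apply/andP; split.
  apply/bigmax_leqP=> S clS; rewrite (card_imset _ f_inj); exact: clique_le.
exact: leq_bigmax_cond.
Qed.

(** The hypotheses say that [m] lists the maximal subalgebras, each once. Vertices inside the same
    [m p] generate a subalgebra of [m p], hence are not adjacent. A proper subalgebra containing
    [m p] and [m r] lies in some [m k], which forces [p = k = r]. *)
Lemma comaximal_graph_chromatic_clique (F : finFieldType) (L : lieType F)
    (T : finType) (m : T -> {vspace L}) :
    (forall p, [&& lie_closed (m p), m p != 0%VS & m p != fullv]) ->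
    (forall U : proper_subalgebra L, exists p, (val U <= m p)%VS) ->
    (forall p r, (m p <= m r)%VS -> p = r) ->
  chromatic_number (comaximal_graph L) = #|T| /\
  clique_number (comaximal_graph L) = #|T|.
Proof.
move=> mP above anti.
pose c U := xchoose (above U).
have cP U : (val U <= m (c U))%VS := xchooseP (above U).
pose f p : proper_subalgebra L := exist _ (m p) (mP p).
apply: (@chromatic_clique_card (comaximal_graph L) _ c f) => [U V | p r pr].
  case/andP=> _ /eqP genUV; apply: contraTneq isT => cUV.
  have /and3P[cl _ /negP[]] := mP (c U).
  rewrite eqEsubv subvf -genUV /=; apply: (@bigcapv_inf _ _ _ (m (c U))) => //.
  by rewrite cl cP cUV cP.
rewrite /= /comaximal -val_eqE /= (contraNneq _ pr) /=; last first.
  by move=> e; apply/eqP/anti; rewrite e.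
rewrite eqEsubv subvf; apply/subv_bigcapP=> M /and3P[clM pM rM].
suff /eqP-> : M == fullv by [].
apply: contraNT pr => M_prop.
have M_nz : M != 0%VS.
  have /and3P[_ + _] := mP p; apply: contraNneq => M0; move: pM.
  by rewrite M0 subv0.
have MP : [&& lie_closed M, M != 0%VS & M != fullv] by rewrite clM M_nz.
have [k /= Mk] := above (Sub M MP).
by rewrite (anti p k (subv_trans pM Mk)) (anti r k (subv_trans rM Mk)).
Qed.

Lemma dim_add_vline (F : fieldType) (V : vectType F) (x y : V) :
  x != 0 -> y \notin <[x]>%VS -> \dim (<[x]> + <[y]>) = 2.
Proof.
move=> x_nz yx; rewrite addvC dimv_disjoint_sum.
  rewrite !dim_vline x_nz (contraNneq _ yx) => [//|->]; exact: mem0v.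
apply/eqP; rewrite -subv0; apply/subvP=> _ /memv_capP[/vlineP[k ->]].
by rewrite rpredZeq (negPf yx) orbF => /eqP->; rewrite scale0r mem0v.
Qed.

(** * Counting nonsquares in a finite field of odd order *)

Section Nonsquares.
Variable F : finFieldType.

Definition nonsquare (d : F) := [forall x, x ^+ 2 != d].

Hypothesis odd_F : odd #|F|.

Lemma odd_card_two_neq0 : (2%:R : F) != 0.
Proof.
(* By Lagrange in the additive group, [#|F|] times 1 is 0; if 2 = 0, the odd number [#|F|] also acts
   as 1. *)
apply/eqP=> F2; have /eqP := expg_cardG (in_setT (1 : F)).
rewrite FinRing.zmodXgE cardsT -(odd_double_half #|F|) odd_F -mul2n mulrnDr mulrnA.
by rewrite F2 mul0rn addr0 oner_eq0.
Qed.

(** A fibre of squaring has 0, 1 or 2 points according as [d] is a nonsquare, zero or a nonzero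
    square. The identity [fiber] treats these uniformly; summed over [d], with N nonsquares, it
    reads q + 2N + 1 = 2q. *)
Lemma card_nonsquare : ((#|[pred d | nonsquare d]|).*2.+1 = #|F|)%N.
Proof.
have F2 := odd_card_two_neq0.
have fiber (d : F) :
    (#|[pred x : F | x ^+ 2 == d]| + ((nonsquare d).*2 + (d == 0)%R) = 2)%N.
  have [/forallP nsq | /forallPn[y]] := boolP (nonsquare d).
    rewrite (eq_card0 (_ : _ =i pred0)) => [|x]; last first.
      by rewrite !inE (negPf (nsq x)).
    by have /negPf := nsq 0; rewrite expr0n /= eq_sym => ->.
  rewrite negbK => /eqP <-; rewrite sqrf_eq0.
  rewrite (eq_card (_ : _ =i pred2 y (- y))) => [|x]; last first.
    by rewrite !inE eqf_sqr.
  rewrite card2 -addr_eq0 -mulr2n -mulr_natl mulf_eq0 (negPf F2) /=.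
  by case: (y == 0).
have : (\sum_(d : F)
    (#|[pred x : F | x ^+ 2 == d]| + ((nonsquare d).*2 + (d == 0)%R)) =
    \sum_(d : F) 2)%N.
  by apply: eq_bigr => d _; apply: fiber.
rewrite !big_split /= sum_nat_const.
have -> : (\sum_(d : F) #|[pred x : F | x ^+ 2 == d]| = #|F|)%N.
  rewrite -[RHS]sum1_card [RHS](partition_big (fun x : F => x ^+ 2) predT) //=.
  by apply: eq_bigr => d _; rewrite -sum1_card.
have -> : (\sum_(d : F) (d == 0%R) = 1)%N.
  by rewrite (bigD1 0) //= eqxx big1 // => d /negPf->.
have -> : (\sum_(d : F) (nonsquare d).*2 = (#|[pred d | nonsquare d]|).*2)%N.
  rewrite -sum1_card -mul2n big_distrr /= [RHS]big_mkcond /=.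
  by apply: eq_bigr => d _; rewrite inE; case: (nonsquare d).
by rewrite mulnC mul2n -[RHS]addnn addn1 => /eqP; rewrite eqn_add2l => /eqP.
Qed.

End Nonsquares.

(** * Coordinates, bracket and dimension of sl_2 *)

Section SL2.
Variable F : finFieldType.
Local Notation L := (sl F 2).
Implicit Types (x y : L) (U : {vspace L}) (t : option F).

Definition sl2a x := vsval x 0 0.
Definition sl2b x := vsval x 0 1.
Definition sl2c x := vsval x 1 0.

Lemma sl2_11 x : vsval x 1 1 = - sl2a x.
Proof.
have := subvsP x.
rewrite sl_spaceE /mxtrace !big_ord_recl big_ord0 addr0 addrC addr_eq0 => /eqP <-.
by congr (vsval x _ _); apply: val_inj.
Qed.

Lemma sl2_ext x y : sl2a x = sl2a y -> sl2b x = sl2b y -> sl2c x = sl2c y -> x = y.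
Proof.
move=> ea eb ec; apply: val_inj; apply/matrixP => i j.
have ord2 (k : 'I_2) : k = 0 \/ k = 1.
  by case: k => [[|[|]]] // lt_k; [left | right]; apply: val_inj.
by case: (ord2 i) (ord2 j) => -> [] -> //; rewrite !sl2_11 ea.
Qed.

Definition sl2_mx (a b c : F) : 'M[F]_2 :=
  \matrix_(i, j) if i == 0 then if j == 0 then a else b
                 else if j == 0 then c else - a.

Lemma sl2_mx_sl a b c : sl2_mx a b c \in sl_space F 2.
Proof.
by rewrite sl_spaceE /mxtrace !big_ord_recl big_ord0 !mxE /= addr0 subrr.
Qed.

Definition sl2_mk a b c : L := Subvs (sl2_mx_sl a b c).

Lemma sl2a_mk a b c : sl2a (sl2_mk a b c) = a. Proof. by rewrite /sl2a mxE. Qed.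
Lemma sl2b_mk a b c : sl2b (sl2_mk a b c) = b. Proof. by rewrite /sl2b mxE. Qed.
Lemma sl2c_mk a b c : sl2c (sl2_mk a b c) = c. Proof. by rewrite /sl2c mxE. Qed.
Definition sl2_mkE := (sl2a_mk, sl2b_mk, sl2c_mk).

Lemma sl2a_linear : linear (sl2a : L -> F^o).
Proof. by move=> k x y; rewrite /sl2a !mxE. Qed.
Lemma sl2b_linear : linear (sl2b : L -> F^o).
Proof. by move=> k x y; rewrite /sl2b !mxE. Qed.
Lemma sl2c_linear : linear (sl2c : L -> F^o).
Proof. by move=> k x y; rewrite /sl2c !mxE. Qed.
HB.instance Definition _ := GRing.isLinear.Build F L F^o *:%R sl2a sl2a_linear.
HB.instance Definition _ := GRing.isLinear.Build F L F^o *:%R sl2b sl2b_linear.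
HB.instance Definition _ := GRing.isLinear.Build F L F^o *:%R sl2c sl2c_linear.

Lemma sl2aZ k x : sl2a (k *: x) = k * sl2a x. Proof. exact: linearZ. Qed.
Lemma sl2bZ k x : sl2b (k *: x) = k * sl2b x. Proof. exact: linearZ. Qed.
Lemma sl2cZ k x : sl2c (k *: x) = k * sl2c x. Proof. exact: linearZ. Qed.
Definition sl2_scaleE := (sl2aZ, sl2bZ, sl2cZ).

Lemma sl2_mulmxE (A B : 'M[F]_2) i j :
  (A *m B) i j = A i 0 * B 0 j + A i 1 * B 1 j.
Proof.
rewrite mxE !big_ord_recl big_ord0 addr0.
by congr (_ + A i _ * B _ j); apply: val_inj.
Qed.

Lemma sl2_lie_entry x y i j : vsval (lie x y) i j =
  (vsval x i 0 * vsval y 0 j + vsval x i 1 * vsval y 1 j) -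
  (vsval y i 0 * vsval x 0 j + vsval y i 1 * vsval x 1 j).
Proof. by rewrite [LHS]mxE [X in _ + X]mxE !sl2_mulmxE. Qed.

Lemma sl2a_lie x y : sl2a (lie x y) = sl2b x * sl2c y - sl2c x * sl2b y.
Proof. by rewrite /sl2a sl2_lie_entry /sl2b /sl2c; ring. Qed.

Lemma sl2b_lie x y : sl2b (lie x y) = 2 * (sl2a x * sl2b y - sl2b x * sl2a y).
Proof. by rewrite /sl2b sl2_lie_entry !sl2_11 /sl2a; ring. Qed.

Lemma sl2c_lie x y : sl2c (lie x y) = 2 * (sl2c x * sl2a y - sl2a x * sl2c y).
Proof. by rewrite /sl2c sl2_lie_entry !sl2_11 /sl2a; ring. Qed.

Definition sl2_lieE := (sl2a_lie, sl2b_lie, sl2c_lie).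

Lemma dim_sl2 : \dim {:L} = 3%N.
Proof.
rewrite dimvf -[LHS]/(\dim (sl_space F 2)).
have := limg_ker_dim (linfun (mxtrace : 'M[F]_2 -> F^o)) fullv.
rewrite capfv dimvf dim_matrix -/(sl_space F 2).
suff -> : limg (linfun (mxtrace : 'M[F]_2 -> F^o)) = fullv.
  by rewrite dimvf addn1 => -[].
apply/eqP; rewrite eqEsubv subvf; apply/subvP=> z _.
apply/memv_imgP; exists (z *: delta_mx 0 0); first exact: memvf.
by rewrite lfunE /= /mxtrace !big_ord_recl big_ord0 !mxE /= mulr0 mulr1 !addr0.
Qed.

(** * Borel subalgebras and elliptic lines *)

(* The stabiliser of the column (1, s) for [Some s], of (0, 1) for [None]. *)
Definition borel_form t x : F :=
  if t is Some s then sl2c x - 2 * s * sl2a x - s ^+ 2 * sl2b x else sl2b x.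

Lemma borel_form_linear t : linear (borel_form t : L -> F^o).
Proof.
case: t => [s|] k x y /=; rewrite !linearP //= /GRing.scale /=; ring.
Qed.
HB.instance Definition _ t :=
  GRing.isLinear.Build F L F^o *:%R (borel_form t) (borel_form_linear t).

Definition borel t : {vspace L} := lker (linfun (borel_form t : L -> F^o)).

Lemma mem_borel t x : (x \in borel t) = (borel_form t x == 0).
Proof. by rewrite memv_ker lfunE. Qed.

(** The traceless matrix with diagonal entry [a] and upper right entry 1 whose square is the scalar
    [d]; its eigenvalues are the square roots of [d]. *)
Definition elliptic (a d : F) : L := sl2_mk a 1 (d - a ^+ 2).

Definition maximal_index : finType := (option F + F * {d : F | nonsquare d})%type.

Definition maximal_subalgebra (p : maximal_index) : {vspace L} :=
  match p with inl t => borel t | inr (a, d) => <[elliptic a (val d)]>%VS end.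

Lemma elliptic_notin_borel t a d : nonsquare d -> elliptic a d \notin borel t.
Proof.
move=> /forallP nsq; rewrite mem_borel /elliptic.
case: t => [s|] /=; rewrite !sl2_mkE ?oner_eq0 //.
(* The form of the point (1, s) takes the value d - (a + s)^2 here. *)
apply: contra (nsq (a + s)) => /eqP e; rewrite eq_sym -subr_eq0; apply/eqP.
by rewrite -[RHS]e; ring.
Qed.

Lemma sl2_mem_maximal x : exists p, x \in maximal_subalgebra p.
Proof.
have [b0 | b_nz] := eqVneq (sl2b x) 0.
  by exists (inl None); rewrite mem_borel /= b0.
(* After scaling the upper right entry to 1, [d] is minus the determinant. If d = s^2, then (1, s -
   a) is an eigenvector, of eigenvalue s for the scaled matrix. *)
pose a := sl2a x / sl2b x; pose d := a ^+ 2 + sl2c x / sl2b x.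
have [nsq | /forallPn[s]] := boolP (nonsquare d).
  exists (inr (a, Sub d nsq)); apply/vlineP; exists (sl2b x).
  apply: sl2_ext; rewrite sl2_scaleE /elliptic !sl2_mkE /= /d /a; by field.
rewrite negbK => /eqP sd; exists (inl (Some (s - a))); rewrite mem_borel /=.
have -> : sl2c x = sl2b x * (s ^+ 2 - a ^+ 2) by rewrite sd /d; field.
by apply/eqP; rewrite /a; field.
Qed.

(** The condition on [sl2b] serves to separate Borel subalgebras from elliptic lines, whose nonzero
    elements have a nonzero upper right entry. *)
Lemma borel_neq0 t : exists2 x, x \in borel t & (x != 0) && (sl2b x == 0).
Proof.
case: t => [s|].
  exists (sl2_mk 1 0 (2 * s)).
    by rewrite mem_borel /= !sl2_mkE; apply/eqP; ring.
  rewrite sl2_mkE eqxx andbT; apply: contraTneq isT => /(congr1 sl2a).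
  by rewrite sl2_mkE linear0 => /eqP; rewrite oner_eq0.
exists (sl2_mk 0 0 1); first by rewrite mem_borel /= !sl2_mkE.
rewrite sl2_mkE eqxx andbT; apply: contraTneq isT => /(congr1 sl2c).
by rewrite sl2_mkE linear0 => /eqP; rewrite oner_eq0.
Qed.

Lemma elliptic_neq0 a d : elliptic a d != 0.
Proof.
apply: contraTneq isT => /(congr1 sl2b).
by rewrite sl2_mkE linear0 => /eqP; rewrite oner_eq0.
Qed.

Lemma borel_closed t : lie_closed (borel t).
Proof.
apply/lie_closedP=> x y; rewrite !mem_borel.
case: t => [s|] /=; last first.
  by rewrite sl2b_lie => /eqP-> /eqP->; rewrite mulr0 mul0r subrr mulr0.
rewrite !sl2_lieE => /eqP hx /eqP hy; apply/eqP.
have -> : sl2c x = 2 * s * sl2a x + s ^+ 2 * sl2b x.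
  by apply/eqP; rewrite -subr_eq0 opprD addrA hx.
have -> : sl2c y = 2 * s * sl2a y + s ^+ 2 * sl2b y.
  by apply/eqP; rewrite -subr_eq0 opprD addrA hy.
ring.
Qed.

Lemma line_closed x : lie_closed <[x]>%VS.
Proof.
apply/lie_closedP=> _ _ /vlineP[k ->] /vlineP[l ->].
suff -> : lie (k *: x) (l *: x) = 0 by apply: mem0v.
by apply: sl2_ext; rewrite linear0 sl2_lieE !sl2_scaleE; ring.
Qed.

(** * Classification of the maximal subalgebras *)

Hypothesis F2 : (2 : F) != 0.

Lemma maximal_subalgebra_inj p r :
  (maximal_subalgebra p <= maximal_subalgebra r)%VS -> p = r.
Proof.
case: p r => [s | [a [d nsq]]] [t | [a' [d' nsq']]] /=.
- case: s t => [s|] [t|] // /subvP sub_st.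
  (* This element has eigenvectors (1, s) and (0, 1), with eigenvalues 1 and -1, distinct because 2
     is nonzero; so it stabilises no other point. *)
  + have /sub_st : sl2_mk 1 0 (2 * s) \in borel (Some s).
      by rewrite mem_borel /= !sl2_mkE; apply/eqP; ring.
    rewrite mem_borel /= !sl2_mkE mulr0 subr0 mulr1 -mulrBr mulf_eq0 (negPf F2) /=.
    by rewrite subr_eq0 => /eqP->.
  (* This element stabilises (1, s) but moves (0, 1). *)
  + have /sub_st : sl2_mk 0 1 (s ^+ 2) \in borel (Some s).
      by rewrite mem_borel /= !sl2_mkE; apply/eqP; ring.
    by rewrite mem_borel /= sl2_mkE oner_eq0.
  (* A nonzero nilpotent element stabilises only its kernel, here (0, 1). *)
  + have /sub_st : sl2_mk 0 0 1 \in borel None by rewrite mem_borel /= sl2_mkE.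
    by rewrite mem_borel /= !sl2_mkE !mulr0 !subr0 oner_eq0.
- move=> /subvP sub_sa; have [x /sub_sa/vlineP[k ->]] := borel_neq0 s.
  by rewrite sl2bZ sl2_mkE mulr1 => /andP[/eqP + /eqP k0]; rewrite k0 scale0r.
- by rewrite -memvE (negPf (elliptic_notin_borel _ _ nsq)).
- rewrite -memvE => /vlineP[k e].
  have := congr1 sl2b e; rewrite sl2bZ !sl2_mkE mulr1 => k1.
  move: e; rewrite -k1 scale1r => e.
  have := congr1 sl2a e; rewrite !sl2_mkE => ea.
  have := congr1 sl2c e; rewrite !sl2_mkE ea => /addIr ed.
  by congr (inr (_, _)); apply: val_inj.
Qed.

(** Up to sign and factors 2, the coordinates of the bracket are the 2 by 2 minors of the
    coordinates of [x] and [y]. When they vanish, the ratio at any nonzero coordinate of [x] is the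
    proportionality factor. *)
Lemma sl2_lie_eq0 x y : x != 0 -> lie x y = 0 -> y \in <[x]>%VS.
Proof.
move=> x_nz xy0.
have := congr1 sl2a xy0; rewrite sl2a_lie linear0 => /eqP.
rewrite subr_eq0 => /eqP ha.
have := congr1 sl2b xy0; rewrite sl2b_lie linear0 => /eqP.
rewrite mulf_eq0 (negPf F2) subr_eq0 /= => /eqP hb.
have := congr1 sl2c xy0; rewrite sl2c_lie linear0 => /eqP.
rewrite mulf_eq0 (negPf F2) subr_eq0 /= => /eqP hc.
have solve (k u v v' : F) : k != 0 -> k * v = u * v' -> v = v' / k * u.
  by move=> k_nz e; apply: (mulfI k_nz); rewrite e; field.
apply/vlineP.
have [a0 | a_nz] := eqVneq (sl2a x) 0; last first.
  exists (sl2a y / sl2a x); apply: sl2_ext; rewrite sl2_scaleE.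
  - by field.
  - exact: solve a_nz hb.
  - exact: solve a_nz (esym hc).
have [b0 | b_nz] := eqVneq (sl2b x) 0; last first.
  exists (sl2b y / sl2b x); apply: sl2_ext; rewrite sl2_scaleE.
  - exact: solve b_nz (esym hb).
  - by field.
  - exact: solve b_nz ha.
have [c0 | c_nz] := eqVneq (sl2c x) 0; last first.
  exists (sl2c y / sl2c x); apply: sl2_ext; rewrite sl2_scaleE.
  - exact: solve c_nz hc.
  - exact: solve c_nz (esym ha).
  - by field.
by case/eqP: x_nz; apply: sl2_ext; rewrite linear0.
Qed.

Lemma sl2_dim2_borel x y : x != 0 -> y \notin <[x]>%VS ->
  lie x y \in (<[x]> + <[y]>)%VS -> exists t, (x \in borel t) && (y \in borel t).
Proof.
move=> x_nz yx /memv_addP[_ /vlineP[k ->] [_ /vlineP[l ->] w_def]].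
have w_nz : lie x y != 0 by apply: contraNneq yx; apply: sl2_lie_eq0.
set w := lie x y in w_def w_nz.
(* [kappa u] is the trace of [w u]. *)
pose kappa u := 2 * sl2a w * sl2a u + sl2b w * sl2c u + sl2c w * sl2b u.
have kappaD (r s : F) u v : kappa (r *: u + s *: v) = r * kappa u + s * kappa v.
  by rewrite /kappa !raddfD /= !sl2_scaleE; ring.
have kx : kappa x = 0 by rewrite /kappa !sl2_lieE; ring.
have ky : kappa y = 0 by rewrite /kappa !sl2_lieE; ring.
(* [kappa] vanishes on [x] and [y], hence on [w], and [kappa w] is -2 det w; so [w] is nilpotent. *)
have kw : sl2a w ^+ 2 = - (sl2b w * sl2c w).
  apply: (mulfI F2); have -> : 2 * sl2a w ^+ 2 = kappa w - 2 * sl2b w * sl2c w.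
    by rewrite /kappa; ring.
  suff -> : kappa w = k * kappa x + l * kappa y by rewrite kx ky; ring.
  by rewrite -kappaD -w_def.
(* The required point is the kernel of [w]: (0, 1) when its upper right entry is 0, and (1, -a/b)
   otherwise, with a and b the entries of [w]. *)
have [b0 | b_nz] := eqVneq (sl2b w) 0.
  have a0 : sl2a w = 0 by apply/eqP; rewrite -sqrf_eq0 kw b0 mul0r oppr0.
  have c_nz : sl2c w != 0.
    by apply: contraNneq w_nz => c0; apply/eqP/sl2_ext; rewrite linear0.
  move: kx ky; rewrite /kappa a0 b0 mulr0 !mul0r !add0r => /eqP + /eqP.
  rewrite !mulf_eq0 (negPf c_nz) /= => bx by0.
  by exists None; rewrite !mem_borel /= bx.
have inB u : kappa u = 0 -> u \in borel (Some (- sl2a w / sl2b w)).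
  move=> ku; rewrite mem_borel /=; apply/eqP/(mulfI b_nz).
  (* By nilpotency, c = -a^2/b for the lower left entry c of [w], so [sl2b w] times the form of this
     point is [kappa]. *)
  rewrite mulr0 -[RHS]ku /kappa.
  transitivity (sl2b w * sl2c u + 2 * sl2a w * sl2a u
                - sl2a w ^+ 2 / sl2b w * sl2b u); first by field.
  by rewrite kw; field.
by exists (Some (- sl2a w / sl2b w)); rewrite !inB.
Qed.

Lemma maximal_subalgebra_proper p :
  [&& lie_closed (maximal_subalgebra p), maximal_subalgebra p != 0%VS
    & maximal_subalgebra p != fullv].
Proof.
apply/and3P; split.
- by case: p => [t | [a d]]; [apply: borel_closed | apply: line_closed].
- case: p => [t | [a d]] /=.
    have [x tx /andP[x_nz _]] := borel_neq0 t.
    by apply: contraNneq x_nz => t0; rewrite -memv0 -t0.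
  by rewrite -dimv_eq0 dim_vline elliptic_neq0.
(* If the subalgebra of [p] were everything, it would contain that of any other index; [r] is a
   Borel index chosen different from [p]. *)
pose r : maximal_index := inl (if p == inl None then Some 0 else None).
have pr : r != p.
  rewrite /r; case: (p =P inl None) => [-> | /eqP/negPf] //.
  by rewrite eq_sym => ->.
apply: contraNneq pr => p_full; apply/eqP/maximal_subalgebra_inj.
by rewrite p_full subvf.
Qed.

Lemma sub_maximal_subalgebra U :
  lie_closed U -> U != fullv -> exists p, (U <= maximal_subalgebra p)%VS.
Proof.
move=> /lie_closedP clU U_prop; set x := vpick U.
(* The first case includes U = 0, where [vpick] returns 0. In the second, U has dimension at least 2
   and, being proper, is spanned by [x] and [y]. *)
have [Ux | /subvPn[y Uy yx]] := boolP (U <= <[x]>)%VS.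
  have [p px] := sl2_mem_maximal x; exists p.
  by apply: subv_trans Ux _; rewrite -memvE.
have x_nz : x != 0.
  rewrite vpick0; apply: contraNneq yx => U0.
  by move: Uy; rewrite U0 memv0 => /eqP->; apply: mem0v.
have xyU : (<[x]> + <[y]> <= U)%VS by rewrite subv_add -!memvE memv_pick.
have U_def : U = (<[x]> + <[y]>)%VS.
  apply/esym/eqP; rewrite eqEdim xyU dim_add_vline //.
  rewrite -ltnS -dim_sl2 ltnNge; apply: contra U_prop => U3.
  by rewrite eqEdim subvf.
have [|t /andP[tx ty]] := sl2_dim2_borel x_nz yx.
  by rewrite -U_def clU // memv_pick.
by exists (inl t); rewrite U_def subv_add -!memvE tx.
Qed.

Lemma card_maximal_index :
  odd #|F| -> #|{: maximal_index}| = ((#|F| ^ 2 + #|F| + 2) %/ 2)%N.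
Proof.
move=> odd_F; rewrite card_sum card_option card_prod card_sig.
rewrite -(card_nonsquare odd_F).
set n := #|_|; rewrite -muln2.
(* With n nonsquares, q = 2n + 1: there are 2n + 2 Borel subalgebras and (2n + 1)n elliptic lines,
   and the halving is exact. *)
have -> : ((n * 2).+1 ^ 2 + (n * 2).+1 + 2 = ((n * 2).+2 + (n * 2).+1 * n) * 2)%N.
  by ring.
by rewrite mulnK.
Qed.

End SL2.

Theorem theorem4p17 (F : finFieldType) (q : nat) (hq : #|F| = q) (hodd : odd q) :
  chromatic_number (comaximal_graph (sl F 2)) = clique_number (comaximal_graph (sl F 2))
  /\ clique_number (comaximal_graph (sl F 2)) = ((q ^ 2 + q + 2) %/ 2)%N.
Proof.
move: hodd; rewrite -hq => odd_F; have F2 := odd_card_two_neq0 odd_F.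
have [|||-> ->] :=
  @comaximal_graph_chromatic_clique F (sl F 2) _ (@maximal_subalgebra F).
- exact: maximal_subalgebra_proper.
- by move=> U; have /and3P[clU _ U_prop] := valP U; apply: sub_maximal_subalgebra.
- by move=> p r; apply: maximal_subalgebra_inj.
by rewrite card_maximal_index.
Qed.
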